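(* Let $d\ge 3$, and let $T_d$ and $r_d$ be the symmetric polynomial and the constant defined in the context. On the $d$-dimensional simplex, $$E_{d-1}(x_1\cdots x_d;T^d) = E_{d-1}\bigl(x_1\cdots x_{d-1}(1-x_1-\cdots-x_{d-1});T^{d-1}\bigr)\ \ge\ r_d^{-1},$$ and the equality holds for $d=3,4,5$ with $r_d^{-1}T_d(x)$, $x\in\mathbb{R}^d$, as a polynomial of least deviation from zero. Furthermore, on $B^d$ and $S^{d-1}$, $$E_{2d-1}(x_1^2\cdots x_d^2;B^d) = E_{2d-1}(x_1^2\cdots x_d^2;S^{d-1})\ \ge\ r_d^{-2},$$ and the equality holds, for $d=3,4,5$, with $r_d^{-2}T_d(x_1^2,\ldots,x_d^2)$ as a polynomial of least deviation from zero.
   Context: $\Pi_n^d$ is the space of real polynomials of total degree at most $n$ in $d$ variables. For compact $\Omega\subset\mathbb{R}^d$, $\|f\|_{C(\Omega)}=\max_{x\in\Omega}|f(x)|$, and for $f\in C(\Omega)$ here $E_m(f;\Omega)=\inf_{p\in\Pi_m^d}\|f-p\|_{C(\Omega)}$ (for $\Omega=S^{d-1}\subset\mathbb{R}^d$ polynomials in $\Pi_m^d$ are restricted to the sphere). If $p^*\in\Pi^d_{|\alpha|-1}$ attains $\inf_{p\in\Pi^d_{|\alpha|-1}}\|x^\alpha-p\|_{C(\Omega)}$, then $x^\alpha-p^*(x)$ is called a polynomial of least deviation from zero (for $x^\alpha$ on $\Omega$). Domains: $B^d=\{x\in\mathbb{R}^d:\|x\|\le1\}$ (Euclidean norm), $S^{d-1}=\{x\in\mathbb{R}^d:\|x\|=1\}$,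 $T^d=\{x\in\mathbb{R}^d:x_1\ge0,\ldots,x_d\ge0,\ 1-x_1-\cdots-x_d\ge0\}$. Definition of $T_k$ and $r_k$: let $e_k(x)=\sum_{1\le i_1<\cdots<i_k\le N}x_{i_1}\cdots x_{i_k}$ be the elementary symmetric polynomial of degree $k$ in $N$ variables $x=(x_1,\ldots,x_N)$, with $e_k=0$ if $k>N$. As symmetric polynomials in any number $N$ of variables, put $$T_3(x)=72e_3(x)-4e_1(x)+4e_1(x)^2-8e_2(x)+1,\qquad r_3=72,$$ and for $k>3$, recursively, $$T_k(x)=r_ke_k(x)-T_{k-1}(x),\qquad r_k=k^k\bigl[T_{k-1}(k^{-1}\mathbf{1}^k)+1\bigr],$$ where $k^{-1}\mathbf{1}^k=(1/k,\ldots,1/k)\in\mathbb{R}^k$ and $T_{k-1}$ is evaluated there as a function of $k$ variables.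
   Formalization: On the ball and sphere, r_d^{-2} is replaced by r_d^{-1} in the lower bound, the equality for d=3,4,5 and the extremal polynomial; as printed the equality fails for d=3 (the error is 1/72, not 1/5184) and r_d^{-2}T_d(x_1^2,...,x_d^2) is not monic. *)

(* Defs.v *)
From HB Require Import structures.
From mathcomp Require Import all_boot all_order all_algebra.
From mathcomp Require Import classical_sets reals.
From mathcomp Require Import mpoly.

Set Implicit Arguments.
Unset Strict Implicit.
Unset Printing Implicit Defensive.
Import Order.TTheory GRing.Theory Num.Theory.
Local Open Scope classical_set_scope.
Local Open Scope ring_scope.

Section Domains.
Variables (R : realType) (d : nat).
Implicit Types x : 'rV[R]_d.

(* The library norm on row vectors is the sup norm. *)
Definition enorm x : R := Num.sqrt (\sum_i x ord0 i ^+ 2).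

Definition unit_ball : set 'rV[R]_d := [set x | enorm x <= 1].

(* The unit sphere of R^d, of dimension d - 1. *)
Definition unit_sphere : set 'rV[R]_d := [set x | enorm x = 1].

Definition std_simplex : set 'rV[R]_d :=
  [set x | (forall i, 0 <= x ord0 i) /\ 0 <= 1 - \sum_i x ord0 i].

End Domains.

Section BestApproximation.
Variables (R : realType) (d : nat).
Implicit Types (p q : {mpoly R[d]}) (f : 'rV[R]_d -> R) (Om : set 'rV[R]_d).

Definition peval p : 'rV[R]_d -> R := fun x => p.@[x ord0].

(* [msize p] is the total degree plus one, and 0 for p = 0. *)
Definition polys_le (m : nat) : set {mpoly R[d]} := [set p | (msize p <= m.+1)%N].

(* Meaningful for f continuous on a nonempty compact Om, where the supremum
   is attained; [sup] of an unbounded or empty set is 0. *)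
Definition cnorm Om f : R := sup [set `|f x| | x in Om].

Definition best_error (m : nat) f Om : R :=
  inf [set cnorm Om (fun x => f x - peval p x) | p in polys_le m].

(* q = x^alpha - p with p of degree at most |alpha| - 1 attaining the best
   approximation error of x^alpha on Om; intended for |alpha| > 0. *)
Definition least_deviation (alpha : 'X_{1..d}) Om q : Prop :=
  exists p, [/\ polys_le (mdeg alpha).-1 p,
    cnorm Om (fun x => peval 'X_[alpha] x - peval p x)
      = best_error (mdeg alpha).-1 (peval 'X_[alpha]) Om
    & q = 'X_[alpha] - p].

End BestApproximation.

Definition const_mnm (d c : nat) : 'X_{1..d} := [multinom c | i < d].

(* p(x_1^2, ..., x_d^2). A polynomial with coefficient 1 at x_1 ... x_d goes to
   one with coefficient 1 at x_1^2 ... x_d^2, so a normalizing constant for p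
   normalizes p(x_1^2, ..., x_d^2) too, without being squared. *)
Definition subst_sq (R : realType) (d : nat) (p : {mpoly R[d]}) : {mpoly R[d]} :=
  p \mPo [tuple 'X_i ^+ 2 | i < d].

Section TFamily.
Variable R : realType.

(* T_(j+3) in N variables. N has to vary along the recursion: the coefficient
   of e_k evaluates T_(k-1) in k variables. *)
Fixpoint T_rec (j N : nat) : {mpoly R[N]} :=
  let e i := mesym N R i in
  if j is j'.+1 then
    let k := j'.+4 in
    (k%:R ^+ k * ((T_rec j' k).@[fun=> k%:R^-1] + 1)) *: e k - T_rec j' N
  else 72 *: e 3%N - 4 *: e 1%N + 4 *: e 1%N ^+ 2 - 8 *: e 2%N + 1.

(* Only meaningful for k >= 3; see the recursion lemmas below. *)
Definition Tpoly (k N : nat) : {mpoly R[N]} := T_rec (k - 3) N.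

Definition rconst (k : nat) : R :=
  if (k <= 3)%N then 72 else k%:R ^+ k * ((Tpoly k.-1 k).@[fun=> k%:R^-1] + 1).

(* The coefficient of e_k is normalized to 1, so that for N = k this is
   x_1 ... x_k minus a polynomial of degree at most k - 1. *)
Definition Tmonic (k N : nat) : {mpoly R[N]} := (rconst k)^-1 *: Tpoly k N.

Lemma Tpoly3E N : Tpoly 3 N = 72 *: mesym N R 3 - 4 *: mesym N R 1
  + 4 *: mesym N R 1 ^+ 2 - 8 *: mesym N R 2 + 1.
Proof. by []. Qed.

Lemma rconst3E : rconst 3 = 72.
Proof. by []. Qed.

Lemma rconst_recE k : (3 < k)%N ->
  rconst k = k%:R ^+ k * ((Tpoly k.-1 k).@[fun=> k%:R^-1] + 1).
Proof. by rewrite /rconst; case: leqP. Qed.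

Lemma Tpoly_recE k N : (3 < k)%N ->
  Tpoly k N = rconst k *: mesym N R k - Tpoly k.-1 N.
Proof.
case: k => [|[|[|[|k]]]] // _; rewrite rconst_recE //.
by rewrite /Tpoly !subSS !subn0.
Qed.

End TFamily.

(* Main.v *)
Require Import Defs.
From mathcomp Require Import all_boot all_order all_algebra.
From mathcomp Require Import classical_sets reals.
From mathcomp Require Import mpoly ring lra.

Set Implicit Arguments.
Unset Strict Implicit.
Unset Printing Implicit Defensive.
Import Order.TTheory GRing.Theory Num.Theory.
Local Open Scope ring_scope.

(** Write sigma for the sum of the coordinates. The four best errors are equal
    because of the cyclic chain
      sphere <= ball <= simplex <= face <= sphere,
    proved in [sphere_le_ball], [ball_le_simplex], [simplex_le_face] and
    [face_le_sphere]. Each link turns an approximant on the right-hand domain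
    into one on the left-hand domain that is at least as good; for the first two
    this is restriction and the substitution x_i -> x_i^2. For the last one, the
    average of p over all sign changes is even in every variable, hence a
    polynomial of half the degree in the squares x_i^2, and these squares are the
    barycentric coordinates of a point of the face.

    The link from the simplex to its face sigma = 1 is the delicate one. In n
    variables let P be the product of the coordinates and p a polynomial of degree
    at most n with |P (1 - sigma) - p| <= e on the simplex. If b is the
    homogenization of p to degree n by powers of sigma, then p = (1 - sigma) a + b
    with a of degree at most n - 1. In n + 1 variables take t a + b as approximant
    of t P, where t is the additional variable. The error t (P - a) - b is affine
    in t, so it is enough to look at both ends of 0 <= t <= 1 - sigma. At
    t = 1 - sigma it is P (1 - sigma) - p. At t = 0 it is - b. Where sigma = 1 the
    polynomial b agrees with p and P (1 - sigma) vanishes, so |b| <= e; elsewhere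
    |b| <= sigma^n e follows by homogeneity.

    The lower bound is duality. Let u_S be the barycenter of the face spanned by
    the set S of vertices. The functional
      L(p) = sum over S of (-1)^|S| |S|^(d-1) p(u_S)
    kills all polynomials of degree less than d: after homogenization to degree
    d - 1 it becomes the alternating sum of the values at the vertices of the
    cube [0,1]^d. The constants r_k are chosen such that T_d(u_S) = (-1)^(d+|S|)
    ([Tpoly_flat1]). So T_d attains the norm of L, while L(T_d) = r_d L(e_d),
    because T_d - r_d e_d has degree less than d. Any admissible error function
    e_d - p thus has norm at least 1 / r_d ([simplex_lower_bound]).

    For the upper bound, observe that T_d is affine in x_i x_j as long as
    x_i + x_j and the other coordinates are fixed. Moving two coordinates apart
    or together hence does not decrease T_d in one of the two directions, and a
    finite number of such moves leads to a point whose nonzero coordinates are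
    all equal ([smoothing]). It remains to bound T_d by 1 at the points s u_S with
    0 <= s <= 1, that is, to bound a few polynomials in s. *)

(** * Total degree of polynomial expressions *)

Section Degree.
Variables (R : realType) (n : nat).
Implicit Types p q : {mpoly R[n]}.

Lemma degXU (i : 'I_n) : (msize ('X_i : {mpoly R[n]}) <= 2)%N.
Proof. by rewrite msizeX mdeg1. Qed.

Lemma degD m p q : (msize p <= m -> msize q <= m -> msize (p + q) <= m)%N.
Proof. by move=> hp hq; apply: leq_trans (msizeD_le _ _) _; rewrite geq_max hp. Qed.

Lemma degB m p q : (msize p <= m -> msize q <= m -> msize (p - q) <= m)%N.
Proof. by move=> hp hq; apply: degD => //; rewrite msizeN. Qed.

Lemma degZ m c p : (msize p <= m -> msize (c *: p) <= m)%N.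
Proof. exact: leq_trans (msizeZ_le _ _). Qed.

Lemma degM m k p q :
  (msize p <= m.+1 -> msize q <= k.+1 -> msize (p * q)%R <= (m + k).+1)%N.
Proof.
move=> hp hq; have [->|p0] := eqVneq p 0; first by rewrite mul0r msize0.
have [->|q0] := eqVneq q 0; first by rewrite mulr0 msize0.
by rewrite msizeM // -subn1 leq_subLR add1n (leq_trans (leq_add hp hq)) // addSn addnS.
Qed.

Lemma degXn m k p : (msize p <= m.+1 -> msize (p ^+ k) <= (m * k).+1)%N.
Proof.
move=> hp; elim: k => [|k IH]; first by rewrite expr0 msize1.
by rewrite exprS mulnS; apply: degM.
Qed.

Lemma deg_sum m (I : Type) (r : seq I) (P : pred I) (F : I -> {mpoly R[n]}) :
  (forall i, P i -> (msize (F i) <= m)%N) -> (msize (\sum_(i <- r | P i) F i) <= m)%N.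
Proof.
move=> h; elim/big_ind: _ => [|p q|i]; [by rewrite msize0|exact: degD|exact: h].
Qed.

Lemma deg_prod (I : Type) (r : seq I) (F : I -> {mpoly R[n]}) (w : I -> nat) :
  (forall i, (msize (F i) <= (w i).+1)%N) ->
  (msize (\prod_(i <- r) F i)%R <= (\sum_(i <- r) w i)%N.+1)%N.
Proof.
move=> h; elim: r => [|i r IH]; first by rewrite !big_nil msize1.
by rewrite !big_cons; apply: degM.
Qed.

End Degree.

Lemma deg_comp (R : realType) (n k : nat) (m c : nat) (lq : n.-tuple {mpoly R[k]})
    (p : {mpoly R[n]}) :
  (forall i, (msize (tnth lq i) <= c.+1)%N) -> (msize p <= m.+1)%N ->
  (msize (p \mPo lq) <= (c * m).+1)%N.
Proof.
move=> hq hp; rewrite comp_mpolyE [in msize _]big_seq; apply: deg_sum => M hM; apply: degZ.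
apply: (leq_trans (deg_prod (w := fun i => (c * M i)%N) _ _)) => [i|]; first exact: degXn.
rewrite ltnS -big_distrr /= -mdegE leq_mul2l -ltnS.
by rewrite (leq_trans (msize_mdeg_lt hM) hp) orbT.
Qed.

(** * Best approximation errors *)

Section BestError.
Local Open Scope classical_set_scope.
Variable R : realType.

(** On a subset of the cube every polynomial is bounded by the sum of the absolute
    values of its coefficients. This makes the suprema in [cnorm] genuine without
    any appeal to compactness. *)
Definition in_cube n (Om : set 'rV[R]_n) := forall x, Om x -> forall i, `|x ord0 i| <= 1.

Lemma meval_cube n (p : {mpoly R[n]}) v : (forall i, `|v i| <= 1) ->
  `|p.@[v]| <= \sum_(m <- msupp p) `|p@_m|.
Proof.
move=> hv; rewrite mevalE; apply: (le_trans (ler_norm_sum _ _ _)).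
apply: ler_sum => m _; rewrite normrM ler_piMr // normr_prod.
by apply: prodr_ile1 => i; rewrite normr_ge0 normrX exprn_ile1.
Qed.

Lemma cnorm_le n (Om : set 'rV[R]_n) f e : Om !=set0 ->
  (forall x, Om x -> `|f x| <= e) -> cnorm Om f <= e.
Proof.
move=> [x0 hx0] h; apply: ge_sup; first by exists `|f x0|, x0.
by move=> _ [x hx <-]; apply: h.
Qed.

Lemma cnorm_ge0 n (Om : set 'rV[R]_n) f : 0 <= cnorm Om f.
Proof.
rewrite /cnorm; set E := [set _ | _ in _].
case: (boolp.pselect (has_sup E)) => [[[y Ey] hE]|hE]; last by rewrite sup_out.
by apply: (le_trans _ (ub_le_sup hE Ey)); case: Ey => x _ <-.
Qed.

Lemma le_cnorm n (Om : set 'rV[R]_n) (g p : {mpoly R[n]}) f : in_cube Om ->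
  (forall x, f x = peval g x) ->
  forall x, Om x -> `|f x - peval p x| <= cnorm Om (fun x => f x - peval p x).
Proof.
move=> cO fg x Ox; apply: ub_le_sup; last by exists x.
exists (\sum_(m <- msupp (g - p)) `|(g - p)@_m|) => _ [y Oy <-].
by rewrite fg /peval -mevalB; apply: meval_cube; apply: cO.
Qed.

Lemma best_error_ge n (Om : set 'rV[R]_n) f g m c : in_cube Om ->
  (forall x, f x = peval g x) ->
  (forall p (e : R), (msize p <= m.+1)%N ->
     (forall x, Om x -> `|f x - peval p x| <= e) -> c <= e) ->
  c <= best_error m f Om.
Proof.
move=> cO fg h; apply: lb_le_inf => [|_ [p hp <-]].
  by exists (cnorm Om (fun x => f x - peval 0 x)), 0 => //; rewrite /polys_le /= msize0.
by apply: (h p) => //; apply: le_cnorm fg.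
Qed.

Lemma best_error_le n (Om : set 'rV[R]_n) f m c p : Om !=set0 -> (msize p <= m.+1)%N ->
  (forall x, Om x -> `|f x - peval p x| <= c) -> best_error m f Om <= c.
Proof.
move=> O0 hp h; apply: le_trans (cnorm_le O0 h); apply: ge_inf; last by exists p.
by exists 0 => _ [q _ <-]; apply: cnorm_ge0.
Qed.

(** Errors on two domains are compared by turning approximants for one problem
    into approximants for the other. The quantification over all e stands for the
    comparison of the two norms. *)
Lemma best_error_transfer n k (Om : set 'rV[R]_n) (Om' : set 'rV[R]_k) f f' g m m' :
  Om !=set0 -> in_cube Om' -> (forall x, f' x = peval g x) ->
  (forall p' : {mpoly R[k]}, (msize p' <= m'.+1)%N ->
     exists2 p : {mpoly R[n]}, (msize p <= m.+1)%N &
       forall e : R, (forall y, Om' y -> `|f' y - peval p' y| <= e) ->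
       forall x, Om x -> `|f x - peval p x| <= e) ->
  best_error m f Om <= best_error m' f' Om'.
Proof.
move=> O0 cO' fg h; apply: best_error_ge fg _ => // p' e /h[p hp hpe] /hpe.
exact: best_error_le.
Qed.

End BestError.

(** * Simplex, ball and sphere *)

Section Domains.
Local Open Scope classical_set_scope.
Variable R : realType.

Lemma simplex_cube n : in_cube (@std_simplex R n).
Proof.
move=> x [x0 sx] i; rewrite ger0_norm //; rewrite subr_ge0 in sx.
by apply: le_trans sx; rewrite (bigD1 i) //= lerDl sumr_ge0.
Qed.

Lemma simplex_neq0 n : @std_simplex R n !=set0.
Proof.
exists 0; split=> [i|]; first by rewrite mxE.
by rewrite big1 ?subr0 // => i _; rewrite mxE.
Qed.

Lemma ballE n (x : 'rV[R]_n) : unit_ball x <-> \sum_i x ord0 i ^+ 2 <= 1.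
Proof.
rewrite /unit_ball /enorm /=; set s := \sum_i _.
have s0 : 0 <= s by apply: sumr_ge0 => i _; apply: sqr_ge0.
by rewrite -[X in _ <= X <-> _]sqrtr1 ler_sqrt.
Qed.

Lemma sphereE n (x : 'rV[R]_n) : unit_sphere x <-> \sum_i x ord0 i ^+ 2 = 1.
Proof.
rewrite /unit_sphere /enorm /=; set s := \sum_i _.
have s0 : 0 <= s by apply: sumr_ge0 => i _; apply: sqr_ge0.
split=> [h|->]; last by rewrite sqrtr1.
by rewrite -(sqr_sqrtr s0) h expr1n.
Qed.

Lemma sphere_ball n : @unit_sphere R n `<=` @unit_ball R n.
Proof. by move=> x /sphereE h; apply/ballE; rewrite h. Qed.

Lemma ball_cube n : in_cube (@unit_ball R n).
Proof.
move=> x /ballE sx i; rewrite -(@expr_le1 _ 2) // real_normK ?num_real //.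
by apply: le_trans sx; rewrite (bigD1 i) //= lerDl sumr_ge0 // => j _; apply: sqr_ge0.
Qed.

Lemma sphere_neq0 n : @unit_sphere R n.+1 !=set0.
Proof.
exists (delta_mx ord0 ord0); apply/sphereE; rewrite big_ord_recl big1 => [|i _].
  by rewrite mxE !eqxx expr1n addr0.
by rewrite mxE /= expr0n.
Qed.

Lemma ball_neq0 n : @unit_ball R n.+1 !=set0.
Proof. by have [x /sphere_ball Bx] := sphere_neq0 n; exists x. Qed.

Lemma sphere_cube n : in_cube (@unit_sphere R n).
Proof. by move=> x /sphere_ball; apply: ball_cube. Qed.

Lemma ball_sq_simplex n (x : 'rV[R]_n) :
  unit_ball x -> std_simplex (\row_i x ord0 i ^+ 2).
Proof.
move=> /ballE h; split=> [i|]; first by rewrite mxE sqr_ge0.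
by rewrite subr_ge0; under eq_bigr do rewrite mxE.
Qed.

Lemma peval_subst_sq n (p : {mpoly R[n]}) x :
  peval (subst_sq p) x = peval p (\row_i x ord0 i ^+ 2).
Proof.
rewrite /peval comp_mpoly_meval; apply: meval_eq => i.
by rewrite tnth_mktuple mxE rmorphXn /= mevalXU.
Qed.

Lemma deg_subst_sq n (p : {mpoly R[n]}) m :
  (msize p <= m.+1 -> msize (subst_sq p) <= (2 * m).+1)%N.
Proof.
apply: deg_comp => i; rewrite tnth_mktuple.
by apply: (degXn (m := 1)); apply: degXU.
Qed.

Lemma peval_const_mnm n c (x : 'rV[R]_n) :
  peval 'X_[const_mnm n c] x = \prod_(i < n) x ord0 i ^+ c.
Proof. by rewrite /peval mevalX; under eq_bigr do rewrite mnmE. Qed.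

Lemma peval_prod n (x : 'rV[R]_n) :
  \prod_(i < n) x ord0 i = peval 'X_[const_mnm n 1] x.
Proof. by rewrite peval_const_mnm; under [RHS]eq_bigr do rewrite expr1. Qed.

Lemma sphere_le_ball n f g m : (forall x, f x = peval g x) ->
  best_error m f (@unit_sphere R n.+1) <= best_error m f (@unit_ball R n.+1).
Proof.
move=> fg; apply: best_error_transfer (@sphere_neq0 n) (@ball_cube _) fg _ => p hp.
by exists p => // e h x /sphere_ball; apply: h.
Qed.

Lemma ball_le_simplex n :
  best_error (2 * n.+1).-1 (fun x : 'rV[R]_n.+1 => \prod_(i < n.+1) x ord0 i ^+ 2)
     (@unit_ball R n.+1)
  <= best_error n (fun x : 'rV[R]_n.+1 => \prod_(i < n.+1) x ord0 i) (@std_simplex R n.+1).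
Proof.
apply: best_error_transfer (@ball_neq0 n) (@simplex_cube _) (@peval_prod _) _.
move=> p hp; exists (subst_sq p) => [|e h x /ball_sq_simplex /h].
  by apply: leq_trans (deg_subst_sq hp) _; rewrite ltnS mulnS.
by rewrite peval_subst_sq; congr (`|_ - _| <= _); apply: eq_bigr => i _; rewrite mxE.
Qed.

End Domains.

(** * Averaging over sign changes *)

Section SignAverage.
Variables (R : realType) (n : nat).

Definition even_mnm (m : 'X_{1..n}) := [forall i, ~~ odd (m i)].
Definition half_mnm (m : 'X_{1..n}) := [multinom (m i)./2 | i < n].

(** Averaging a polynomial over all sign changes keeps exactly its monomials with
    even exponents; this is that average, written in the squares of the
    variables. *)
Definition even_half (p : {mpoly R[n]}) : {mpoly R[n]} :=
  \sum_(m <- msupp p | even_mnm m) p@_m *: 'X_[half_mnm m].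

Definition flip (J : {set 'I_n}) (v : 'I_n -> R) i := if i \in J then - v i else v i.

Lemma deg_even_half k p :
  (msize p <= (2 * k).+2 -> msize (even_half p) <= k.+1)%N.
Proof.
move=> hp; rewrite /even_half big_seq_cond; apply: deg_sum => m /andP[hm _].
apply: degZ; rewrite msizeX ltnS.
have : ((mdeg (half_mnm m)).*2 <= k.*2.+1)%N.
  apply: (@leq_trans (mdeg m)).
    rewrite !mdegE -mul2n big_distrr /=; apply: leq_sum => i _.
    by rewrite mnmE mul2n -[leqRHS]odd_double_half leq_addl.
  by rewrite -ltnS -mul2n; apply: leq_trans (msize_mdeg_lt hm) hp.
by move=> /half_leq; rewrite doubleK /= uphalf_double.
Qed.

(** The sum over all sign changes factors over the coordinates, and a coordinate
    with odd exponent contributes a factor 0. *)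
Lemma sum_flip_monomial v (m : 'X_{1..n}) :
  \sum_(J : {set 'I_n}) \prod_i flip J v i ^+ m i =
  if even_mnm m then 2 ^+ n * \prod_i (v i ^+ 2) ^+ half_mnm m i else 0.
Proof.
transitivity (\prod_i ((- v i) ^+ m i + v i ^+ m i)).
  rewrite bigA_distr; apply: eq_bigr => J _; apply: eq_bigr => i _.
  by rewrite /flip; case: ifP.
case: ifPn => [/forallP he|/forallPn[i /negPn oi]]; last first.
  by rewrite (bigD1 i) //= exprNn -signr_odd oi expr1 mulN1r addNr mul0r.
rewrite -[in 2 ^+ n](card_ord n) -prodr_const -big_split /=.
apply: eq_bigr => i _; rewrite exprNn -signr_odd (negbTE (he i)) expr0 mul1r.
rewrite mnmE -exprM mul2n -[in LHS](odd_double_half (m i)) (negbTE (he i)) add0n.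
by rewrite -mulr2n mulr_natl.
Qed.

Lemma sign_average p v :
  2 ^+ n * (even_half p).@[fun i => v i ^+ 2] = \sum_(J : {set 'I_n}) p.@[flip J v].
Proof.
under [RHS]eq_bigr do rewrite mevalE.
rewrite exchange_big /= /even_half raddf_sum /= mulr_sumr big_mkcond /=.
apply: eq_bigr => m _; rewrite -mulr_sumr sum_flip_monomial.
by case: ifP => _; rewrite ?mulr0 // mevalZ mevalX mulrCA.
Qed.

End SignAverage.

(** * The face of the simplex and the sphere *)

Lemma sum_const_sets (R : realType) n (e : R) : \sum_(J : {set 'I_n}) e = 2 ^+ n * e.
Proof.
rewrite sumr_const -cardsT -powersetT card_powerset cardsT card_ord.
by rewrite -[LHS]mulr_natl natrX.
Qed.

Section Face.
Local Open Scope classical_set_scope.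
Variables (R : realType) (n : nat).

Definition face_coords : n.+1.-tuple {mpoly R[n]} :=
  [tuple if unlift ord0 i is Some j then 'X_j else 1 - \sum_(j < n) 'X_j | i < n.+1].

(** The coordinate of index 0 is the slack 1 - sigma, so that [bary] maps the
    simplex in n variables onto the face sigma = 1 in n + 1 variables. *)
Definition bary (y : 'rV[R]_n) (i : 'I_n.+1) : R :=
  if unlift ord0 i is Some j then y ord0 j else 1 - \sum_j y ord0 j.

Lemma bary0 y : bary y ord0 = 1 - \sum_j y ord0 j.
Proof. by rewrite /bary unlift_none. Qed.

Lemma bary_lift y j : bary y (lift ord0 j) = y ord0 j.
Proof. by rewrite /bary liftK. Qed.

Lemma meval_sumX (v : 'I_n -> R) : (\sum_(j < n) 'X_j).@[v] = \sum_j v j.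
Proof. by rewrite raddf_sum; apply: eq_bigr => j _; rewrite /= mevalXU. Qed.

Lemma deg_sumX : (msize (\sum_(j < n) 'X_j : {mpoly R[n]}) <= 2)%N.
Proof. by apply: deg_sum => j _; apply: degXU. Qed.

Lemma peval_face_coords (p : {mpoly R[n.+1]}) y :
  peval (p \mPo face_coords) y = p.@[bary y].
Proof.
rewrite /peval comp_mpoly_meval; apply: meval_eq => i; rewrite tnth_mktuple /bary.
by case: unliftP => [j|] _; rewrite ?mevalXU // mevalB meval1 meval_sumX.
Qed.

Lemma deg_face_coords p m :
  (msize p <= m.+1 -> msize (p \mPo face_coords) <= m.+1)%N.
Proof.
move=> hp; rewrite -[m]mul1n; apply: deg_comp hp => i.
rewrite tnth_mktuple; case: unliftP => [j|] _; first exact: degXU.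
by apply: degB deg_sumX; rewrite msize1.
Qed.

Lemma bary_ge0 y : std_simplex y -> forall i, 0 <= bary y i.
Proof. by move=> [y0 sy] i; rewrite /bary; case: unliftP. Qed.

Lemma peval_face (y : 'rV[R]_n) :
  (\prod_(i < n) y ord0 i) * (1 - \sum_(i < n) y ord0 i)
  = peval ('X_[const_mnm n.+1 1] \mPo face_coords) y.
Proof.
rewrite peval_face_coords mevalX big_ord_recl mnmE bary0 mulrC; congr (_ * _).
by apply: eq_bigr => i _; rewrite mnmE bary_lift.
Qed.

(** The square roots of the barycentric coordinates of a point of the simplex form
    a point w of the sphere, and so do all its sign changes. The approximation
    error of the average of p at w is at most the average of the errors of p. *)
Lemma face_le_sphere :
  best_error n (fun x : 'rV[R]_n =>
       (\prod_(i < n) x ord0 i) * (1 - \sum_(i < n) x ord0 i)) (@std_simplex R n)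
  <= best_error (2 * n.+1).-1 (fun x : 'rV[R]_n.+1 => \prod_(i < n.+1) x ord0 i ^+ 2)
     (@unit_sphere R n.+1).
Proof.
apply: (@best_error_transfer _ _ _ _ _ _ _ 'X_[const_mnm n.+1 2]).
- exact: simplex_neq0.
- exact: sphere_cube.
- by move=> x; rewrite peval_const_mnm.
move=> p hp; exists (even_half p \mPo face_coords).
  by apply/deg_face_coords/deg_even_half; rewrite mulnS in hp.
move=> e he y Sy; pose w i := Num.sqrt (bary y i).
have w2 i : w i ^+ 2 = bary y i by rewrite sqr_sqrtr ?bary_ge0.
rewrite peval_face peval_face_coords peval_face_coords.
rewrite -!(meval_eq _ (fun i => w2 i)).
rewrite -(ler_pM2l (exprn_gt0 n.+1 (ltr0Sn R 1))).
rewrite -{1}(ger0_norm (exprn_ge0 n.+1 (ler0n R 2))) -normrM mulrBr sign_average.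
have -> : 2 ^+ n.+1 * ('X_[const_mnm n.+1 1]).@[fun i => w i ^+ 2] =
   \sum_(J : {set 'I_n.+1}) \prod_i flip J w i ^+ 2.
  rewrite (eq_bigr (fun=> \prod_i w i ^+ 2)); last first.
    by move=> J _; apply: eq_bigr => i _; rewrite /flip; case: ifP; rewrite ?sqrrN.
  rewrite sum_const_sets; congr (_ * _).
  by rewrite mevalX; apply: eq_bigr => i _; rewrite mnmE expr1.
rewrite -sumrB; apply: (le_trans (ler_norm_sum _ _ _)).
rewrite -sum_const_sets.
apply: ler_sum => J _.
have /he : unit_sphere (\row_i flip J w i).
  apply/sphereE; rewrite (eq_bigr (bary y)) => [|i _]; last first.
    by rewrite mxE -w2 /flip; case: ifP; rewrite ?sqrrN.
  by rewrite big_ord_recl bary0; under [X in _ + X]eq_bigr do rewrite bary_lift; rewrite subrK.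
congr (`|_ - _| <= _); last by apply: meval_eq => i; rewrite mxE.
by apply: eq_bigr => i _; rewrite mxE.
Qed.

End Face.

(** * Homogenization by powers of the coordinate sum *)

Section Homogenization.
Variables (R : realType) (n : nat).
Implicit Types (p : {mpoly R[n]}) (v : 'I_n -> R).

Definition homogenize k p : {mpoly R[n]} :=
  \sum_(m <- msupp p) p@_m *: ('X_[m] * (\sum_(i < n) 'X_i) ^+ (k - mdeg m)).

(** The quotient of p - homogenize k p by 1 - sigma: for each monomial,
    1 - sigma^j is divided by 1 - sigma. *)
Definition homog_quot k p : {mpoly R[n]} :=
  \sum_(m <- msupp p) p@_m *: ('X_[m] * \sum_(j < k - mdeg m) (\sum_(i < n) 'X_i) ^+ j).

Lemma homogenizeE k p :
  p = (1 - \sum_(i < n) 'X_i) * homog_quot k p + homogenize k p.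
Proof.
rewrite /homog_quot mulr_sumr -big_split /= [LHS]mpolyE; apply: eq_bigr => m _.
rewrite -scalerAr -scalerDr mulrCA -mulrDr; congr (_ *: _).
rewrite -[1 - _]opprB mulNr -subrX1 opprB addrNK mulr1 //.
Qed.

Lemma deg_homogenize k p : (msize p <= k.+1)%N -> (msize (homogenize k p) <= k.+1)%N.
Proof.
move=> hp; rewrite /homogenize big_seq; apply: deg_sum => m /msize_mdeg_lt hm.
have mk : (mdeg m <= k)%N by rewrite -ltnS (leq_trans hm).
apply: degZ; rewrite -[k in k.+1](subnKC mk); apply: degM; first by rewrite msizeX.
by rewrite -[X in X.+1]mul1n; apply/degXn/deg_sumX.
Qed.

Lemma deg_homog_quot k p : (msize (homog_quot k p) <= k)%N.
Proof.
apply: deg_sum => m _; apply: degZ; case: k => [|k].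
  by rewrite big_ord0 mulr0 msize0.
have [mk|mk] := leqP (mdeg m) k; last first.
  by rewrite (eqP (_ : k.+1 - mdeg m == 0)%N) ?subn_eq0 // big_ord0 mulr0 msize0.
rewrite -[k in leqRHS](subnKC mk); apply: degM; first by rewrite msizeX.
apply: deg_sum => j _.
apply: (leq_trans (degXn (m := 1) _ (@deg_sumX R n))).
by rewrite mul1n ltnS -ltnS -subSn.
Qed.

Lemma homogenize_scale k p v t : (msize p <= k.+1)%N ->
  (homogenize k p).@[fun i => t * v i] = t ^+ k * (homogenize k p).@[v].
Proof.
move=> hp; rewrite /homogenize !raddf_sum mulr_sumr /= big_seq [RHS]big_seq; apply: eq_bigr => m.
move=> /msize_mdeg_lt hm; have mk : (mdeg m <= k)%N by rewrite -ltnS (leq_trans hm).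
rewrite !mevalZ !mevalM !rmorphXn /= !meval_sumX -mulr_sumr exprMn [RHS]mulrCA.
have -> : t ^+ k = t ^+ mdeg m * t ^+ (k - mdeg m) by rewrite -exprD subnKC.
congr (_ * _); rewrite !mevalX.
rewrite (eq_bigr (fun i => t ^+ m i * v i ^+ m i)) => [|i _]; last by rewrite exprMn.
by rewrite big_split /= prodrXr -mdegE; ring.
Qed.

Lemma homogenize_face k p v : \sum_i v i = 1 -> (homogenize k p).@[v] = p.@[v].
Proof.
move=> hv; rewrite [in RHS](homogenizeE k p) mevalD mevalM mevalB meval1 meval_sumX.
by rewrite hv subrr mul0r add0r.
Qed.

End Homogenization.

(** * The simplex and its face *)

Section SimplexLeFace.
Local Open Scope classical_set_scope.
Variables (R : realType) (n : nat).

Lemma deg_lift (p : {mpoly R[n]}) m : (msize p <= m.+1)%N ->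
  (msize (p \mPo [tuple 'X_(lift ord0 i) | i < n] : {mpoly R[n.+1]}) <= m.+1)%N.
Proof.
move=> hp; rewrite -[m]mul1n; apply: deg_comp hp => i.
by rewrite tnth_mktuple degXU.
Qed.

(** The approximant t a + b, with a the quotient and b the homogenization of p and
    t the coordinate of index 0, has an error that is affine in t; the two ends of
    the range of t are controlled by the error of p itself and by homogeneity. *)
Lemma simplex_le_face : (0 < n)%N ->
  best_error n (fun x : 'rV[R]_n.+1 => \prod_(i < n.+1) x ord0 i) (@std_simplex R n.+1)
  <= best_error n (fun x : 'rV[R]_n =>
       (\prod_(i < n) x ord0 i) * (1 - \sum_(i < n) x ord0 i)) (@std_simplex R n).
Proof.
move=> n0; apply: best_error_transfer (@simplex_neq0 _ _) (@simplex_cube _ _) (@peval_face _ _) _.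
move=> p hp; pose lq := [tuple 'X_(lift ord0 i) : {mpoly R[n.+1]} | i < n].
have lqE (r : {mpoly R[n]}) (x : 'I_n.+1 -> R) :
    (r \mPo lq).@[x] = r.@[fun i => x (lift ord0 i)].
  by rewrite comp_mpoly_meval; apply: meval_eq => i; rewrite tnth_mktuple mevalXU.
exists ('X_ord0 * (homog_quot n p \mPo lq) + (homogenize n p \mPo lq)).
  apply: degD; last exact/deg_lift/deg_homogenize.
  have hq : (msize (homog_quot n p) <= n.-1.+1)%N by rewrite prednK // deg_homog_quot.
  by have := degM (degXU R ord0) (deg_lift hq); rewrite add1n prednK.
move=> e he x [x_ge0 sx].
rewrite /peval mevalD mevalM mevalXU !lqE big_ord_recl.
set v := fun i => x ord0 (lift ord0 i); rewrite big_ord_recl in sx.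
have v0 i : 0 <= v i by apply: x_ge0.
have sv : \sum_i v i <= 1 by move: sx (x_ge0 ord0); rewrite -/(\sum_i v i); lra.
have hw (w : 'I_n -> R) : (forall i, 0 <= w i) -> \sum_i w i <= 1 ->
    `|(\prod_i w i) * (1 - \sum_i w i) - p.@[w]| <= e.
  move=> w0 sw; have ew i : (\row_j w j : 'rV[R]_n) ord0 i = w i by rewrite mxE.
  have := he (\row_j w j); rewrite /peval (meval_eq p ew).
  rewrite !(eq_bigr _ (fun i _ => ew i)); apply; split=> [i|]; first by rewrite mxE.
  by rewrite (eq_bigr _ (fun i _ => ew i)) subr_ge0.
(* On the facet where the first coordinate vanishes only the homogenized polynomial is left. *)
have hb : `|(homogenize n p).@[v]| <= e.
  have [s0|s0] := eqVneq (\sum_i v i) 0.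
    have v00 i : v i = 0 by move/psumr_eq0P: s0; apply.
    rewrite (@meval_eq _ _ v (fun i => 0 * v i)) => [|i]; last by rewrite v00 mulr0.
    rewrite homogenize_scale // expr0n (gtn_eqF n0) mul0r normr0.
    exact: le_trans (hw _ v0 sv).
  have sg : 0 < \sum_i v i by rewrite lt0r s0 sumr_ge0.
  set s := \sum_i v i in s0 sg sv.
  have sw : \sum_i (s^-1 * v i) = 1 by rewrite -mulr_sumr mulVf.
  rewrite (@meval_eq _ _ v (fun i => s * (s^-1 * v i))); last first.
    by move=> i; rewrite mulVKf.
  rewrite homogenize_scale // homogenize_face // normrM ger0_norm; last by rewrite exprn_ge0 // ltW.
    apply: (@le_trans _ _ `|p.@[fun i => s^-1 * v i]|).
    by rewrite ler_piMl // exprn_ile1 // ltW.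
  have := hw _ _ (_ : \sum_i s^-1 * v i <= 1); rewrite sw subrr mulr0 sub0r normrN.
  by apply=> // i; rewrite mulr_ge0 ?invr_ge0 // ltW.
have := hw v v0 sv; rewrite -/(\prod_i v i).
set P := \prod_i v i; rewrite [p.@[v]](_ : _ =
   (1 - \sum_i v i) * (homog_quot n p).@[v] + (homogenize n p).@[v]); last first.
  by rewrite {1}(homogenizeE n p) mevalD mevalM mevalB meval1 meval_sumX.
have := x_ge0 ord0; have {sx} : x ord0 ord0 <= 1 - \sum_i v i by move: sx; rewrite -/v; lra.
move: hb (\sum_i v i) => + s; rewrite -/P !ler_norml.
move: (homogenize n p).@[v] (homog_quot n p).@[v] (x ord0 ord0) => b a t.
move=> /andP[b1 b2] ts t0 /andP[h1 h2].
have [Pa|Pa] := lerP a P.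
  have := ler_wpM2r (_ : 0 <= P - a) ts; have := mulr_ge0 t0 (_ : 0 <= P - a).
  by rewrite subr_ge0 => /(_ Pa) ? /(_ Pa) ?; apply/andP; split; lra.
have := ler_wpM2r (_ : 0 <= a - P) ts; have := mulr_ge0 t0 (_ : 0 <= a - P).
by rewrite subr_ge0 => /(_ (ltW Pa)) ? /(_ (ltW Pa)) ?; apply/andP; split; lra.
Qed.
End SimplexLeFace.

(** * Elementary symmetric polynomials and alternating sums *)

Section Elementary.
Variables (R : realType) (n : nat).

(** Vieta in the form that isolates pairs of variables: e_k is the coefficient of
    degree k of the product of the factors 1 + v_i X. *)
Lemma mesym_coef k (v : 'I_n -> R) :
  (mesym n R k).@[v] = (\prod_(i < n) (1 + v i *: 'X))`_k.
Proof.
have -> : \prod_(i < n) (1 + v i *: 'X) =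
    \sum_(J : {set 'I_n}) (\prod_(i in J) v i) *: 'X^#|J|.
  under eq_bigr do rewrite addrC.
  rewrite bigA_distr; apply: eq_bigr => J _.
  rewrite -big_mkcond /= -prodr_const -scaler_prod //.
rewrite coef_sum /mesym raddf_sum /= big_mkcond; apply: eq_bigr => J _.
rewrite coefZ coefXn eq_sym rmorph_prod /=.
case: eqP => _; rewrite ?mulr0 // mulr1.
by apply: eq_bigr => i _; rewrite mevalXU.
Qed.

(** For nonempty S, the barycenter of the face of the simplex spanned by the
    vertices in S, scaled to have coordinate sum s. *)
Definition flat (S : {set 'I_n}) (s : R) : 'rV[R]_n :=
  \row_i (if i \in S then s / #|S|%:R else 0).

Lemma mesym_flat k (S : {set 'I_n}) s :
  (mesym n R k).@[flat S s ord0] = 'C(#|S|, k)%:R * (s / #|S|%:R) ^+ k.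
Proof.
rewrite mesym_coef (eq_bigr (fun i => if i \in S then 1 + (s / #|S|%:R) *: 'X else 1)).
  rewrite -big_mkcond prodr_const exprDn coef_sum.
  have [kS|Sk] := ltnP k #|S|.+1; last first.
    rewrite bin_small // mul0r big1 // => i _.
    rewrite expr1n mul1r coefMn exprZn coefZ coefXn.
    by rewrite (gtn_eqF (leq_trans (ltn_ord i) Sk)) mulr0 mul0rn.
  rewrite (bigD1 (Ordinal kS)) //= big1 ?addr0 => [|i ik].
    by rewrite expr1n mul1r coefMn exprZn coefZ coefXn eqxx mulr1 mulr_natl.
  rewrite expr1n mul1r coefMn exprZn coefZ coefXn.
  rewrite (_ : (k == i) = false) ?mulr0 ?mul0rn //.
  by apply: contra_neqF ik => /eqP ki; apply: val_inj.
by move=> i _; rewrite mxE; case: ifP; rewrite // scale0r addr0.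
Qed.

Lemma sum_flat (S : {set 'I_n}) s : (0 < #|S|)%N -> \sum_i flat S s ord0 i = s.
Proof.
move=> S0; under eq_bigr do rewrite mxE.
rewrite -big_mkcond sumr_const -[LHS]mulr_natr divfK // pnatr_eq0 -lt0n //.
Qed.

Lemma flat_simplex (S : {set 'I_n}) : std_simplex (flat S 1).
Proof.
split=> [i|]; first by rewrite mxE; case: ifP => // _; rewrite divr_ge0 ?ler0n.
have [S0|S0] := posnP #|S|; last by rewrite sum_flat // subrr.
rewrite big1 ?subr0 // => i _; rewrite mxE ifF //.
by rewrite (cards0_eq S0) inE.
Qed.

Lemma deg_mesym k : (msize (mesym n R k) <= k.+1)%N.
Proof. by rewrite mesymE; apply: deg_sum => h /eqP <-; rewrite msizeX mdeg_mesym1. Qed.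

(** On a monomial the sum factors over the coordinates; a monomial of degree less
    than n misses some variable, whose factor is -1 + 1. *)
Lemma alternating_sum (p : {mpoly R[n]}) : (msize p <= n)%N ->
  \sum_(J : {set 'I_n}) (-1) ^+ #|J| * p.@[fun i => (i \in J)%:R] = 0.
Proof.
move=> hp; under eq_bigr do rewrite mevalE mulr_sumr.
rewrite exchange_big big_seq big1 //= => m /msize_mdeg_lt hm.
case: (pickP (fun i => m i == 0%N)) => [i /eqP mi0|m0]; last first.
  have := leq_trans hm hp; rewrite ltnNge mdegE -[X in (X <= _)%N]card_ord -sum1_card.
  by rewrite leq_sum // => i _; rewrite lt0n m0.
transitivity (p@_m * \prod_i (-1 + (0 : R) ^+ m i)).
  rewrite bigA_distr mulr_sumr; apply: eq_bigr => J _; rewrite mulrCA; congr (_ * _).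
  rewrite -prodr_const big_mkcond -big_split; apply: eq_bigr => j _ /=.
  by case: ifP => _; rewrite ?expr1n ?mulr1 ?mul1r.
by rewrite (bigD1 i) //= mi0 expr0 addNr mul0r mulr0.
Qed.

End Elementary.

(** * The annihilating functional and the lower bound *)

Section LowerBound.
Variable R : realType.

(** The weight |S|^n turns the value at the barycenter of S of a polynomial of
    degree at most n into the value of its homogenization at the indicator vector
    of S. *)
Definition face_functional n (p : {mpoly R[n.+1]}) : R :=
  \sum_(J : {set 'I_n.+1}) (-1) ^+ #|J| * (#|J|%:R ^+ n * peval p (flat J 1)).

Lemma face_functionalB n (p q : {mpoly R[n.+1]}) :
  face_functional (p - q) = face_functional p - face_functional q.
Proof.
by rewrite -sumrB; apply: eq_bigr => J _; rewrite /peval mevalB -!mulrBr.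
Qed.

Lemma face_functionalZ n c (p : {mpoly R[n.+1]}) :
  face_functional (c *: p) = c * face_functional p.
Proof. by rewrite mulr_sumr; apply: eq_bigr => J _; rewrite /peval mevalZ; ring. Qed.

Lemma face_functional_eq0 n (p : {mpoly R[n.+1]}) : (0 < n)%N ->
  (msize p <= n.+1)%N -> face_functional p = 0.
Proof.
move=> n0 hp; rewrite -[RHS](alternating_sum (deg_homogenize hp)).
apply: eq_bigr => J _; congr (_ * _).
rewrite (@meval_eq _ _ (fun i => (i \in J)%:R) (fun i => #|J|%:R * flat J 1 ord0 i)).
  rewrite homogenize_scale //.
  have [J0|J0] := posnP #|J|; first by rewrite J0 expr0n (gtn_eqF n0) !mul0r.
  by rewrite homogenize_face ?sum_flat.
move=> i; rewrite mxE; case: ifP => iJ; last by rewrite mulr0.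
by rewrite mulrC divfK // pnatr_eq0 -lt0n; apply/card_gt0P; exists i.
Qed.

Lemma Tpoly_ind (P : nat -> Prop) : P 3 -> (forall k, (3 <= k)%N -> P k -> P k.+1) ->
  forall k, (3 <= k)%N -> P k.
Proof.
move=> P3 PS; elim=> // k IH.
by rewrite leq_eqVlt => /orP[/eqP <-|/[dup] ? /IH]; auto.
Qed.

Lemma deg_Tpoly3_diff N :
  (msize (Tpoly R 3 N - rconst R 3 *: mesym N R 3) <= 3)%N.
Proof.
rewrite Tpoly3E rconst3E (_ : _ - _ = - (4 *: mesym N R 1) + 4 *: mesym N R 1 ^+ 2
  - 8 *: mesym N R 2 + 1); last by ring.
apply: degD; last by rewrite msize1.
apply: degB; last exact/degZ/deg_mesym.
apply: degD; last exact/degZ/(degXn (m := 1))/deg_mesym.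
by rewrite msizeN; apply: degZ; apply: leq_trans (deg_mesym _ _ _) _.
Qed.

Lemma deg_Tpoly N k : (3 <= k)%N -> (msize (Tpoly R k N) <= k.+1)%N.
Proof.
move: k; apply: Tpoly_ind => [|k k3 IH]; last first.
  rewrite Tpoly_recE //; apply: degB; first exact/degZ/deg_mesym.
  exact: leq_trans IH _.
rewrite -[Tpoly R 3 N](subrK (rconst R 3 *: mesym N R 3)).
apply: degD; last exact/degZ/deg_mesym.
exact: leq_trans (deg_Tpoly3_diff N) _.
Qed.

Lemma deg_Tpoly_diff N k : (3 <= k)%N ->
  (msize (Tpoly R k N - rconst R k *: mesym N R k) <= k)%N.
Proof.
case: k => [|[|[|[|k]]]] // _; first exact: deg_Tpoly3_diff.
by rewrite Tpoly_recE // addrAC subrr add0r msizeN deg_Tpoly.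
Qed.

Lemma peval_Tpoly3 N (x : 'rV[R]_N) : peval (Tpoly R 3 N) x =
  72 * (mesym N R 3).@[x ord0] - 4 * (mesym N R 1).@[x ord0]
  + 4 * (mesym N R 1).@[x ord0] ^+ 2 - 8 * (mesym N R 2).@[x ord0] + 1.
Proof.
by rewrite Tpoly3E /peval !(mevalD, mevalB, mevalN, mevalZ, rmorphXn, meval1).
Qed.

(** At these points e_k, and hence T_k, sees only the number of nonzero
    coordinates. This links the value of T_k in k + 1 variables that enters
    r_(k+1) with its values in any other number of variables. *)
Lemma Tpoly_flat_card k N N' (S : {set 'I_N}) (S' : {set 'I_N'}) s : (3 <= k)%N ->
  #|S| = #|S'| -> peval (Tpoly R k N) (flat S s) = peval (Tpoly R k N') (flat S' s).
Proof.
move=> k3 SS'; elim/Tpoly_ind: k / k3 => [|k k3 IH].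
  by rewrite !peval_Tpoly3 !mesym_flat SS'.
rewrite (@Tpoly_recE R k.+1 N) // (@Tpoly_recE R k.+1 N') // /peval !mevalB !mevalZ !mesym_flat.
rewrite SS'; congr (_ - _).
exact: IH.
Qed.

Lemma rconst_flat k N (S : {set 'I_N}) : (3 <= k)%N -> #|S| = k.+1 ->
  rconst R k.+1 = k.+1%:R ^+ k.+1 * (peval (Tpoly R k N) (flat S 1) + 1).
Proof.
move=> k3 Sk.
rewrite rconst_recE //= (@Tpoly_flat_card k N k.+1 S [set: 'I_k.+1]%SET) ?cardsT ?card_ord //.
by congr (_ * (_ + 1)); apply: meval_eq => i; rewrite mxE inE cardsT card_ord div1r.
Qed.

(** The alternation that makes T_k extremal. If |S| <= k, then e_(k+1) vanishes at
    the barycenter of S and the recursion changes the sign; r_(k+1) is the constant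
    for which the value is 1 when |S| = k + 1. *)
Lemma Tpoly_flat1 k N (S : {set 'I_N}) : (3 <= k)%N -> (0 < #|S| <= k)%N ->
  peval (Tpoly R k N) (flat S 1) = (-1) ^+ (k + #|S|).
Proof.
move=> k3; elim/Tpoly_ind: k / k3 N S => [|k k3 IH] N S.
  case/andP=> S0 S3; rewrite peval_Tpoly3 !mesym_flat.
  have bE := (erefl : 'C(1, 1) = 1, erefl : 'C(1, 2) = 0, erefl : 'C(1, 3) = 0,
    erefl : 'C(2, 1) = 2, erefl : 'C(2, 2) = 1, erefl : 'C(2, 3) = 0,
    erefl : 'C(3, 1) = 3, erefl : 'C(3, 2) = 3, erefl : 'C(3, 3) = 1)%N.
  case: #|S| S0 S3 => [|[|[|[|m]]]] // _ _; rewrite !bE -signr_odd [odd _]/=.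
  1-3: by field; rewrite ?oner_neq0 ?pnatr_eq0.
case/andP=> S0 Sk; rewrite Tpoly_recE // /peval mevalB mevalZ mesym_flat.
rewrite leq_eqVlt in Sk; case/orP: Sk => [/eqP Sk|Sk]; last first.
  rewrite bin_small // mul0r mulr0 sub0r -/(peval _ _) IH ?S0 //.
  by rewrite addSn exprS mulN1r.
rewrite (rconst_flat k3 Sk).
rewrite -/(peval _ _) Sk binn div1r mul1r -signr_odd oddD addbb expr0.
by rewrite exprVn mulrAC divff ?expf_neq0 ?pnatr_eq0 // mul1r addrAC subrr add0r.
Qed.

Lemma face_functional_Tpoly n : (2 <= n)%N ->
  face_functional (Tpoly R n.+1 n.+1) =
  (-1) ^+ n.+1 * \sum_(J : {set 'I_n.+1}) #|J|%:R ^+ n.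
Proof.
move=> n2; rewrite mulr_sumr; apply: eq_bigr => J _.
have [J0|J0] := posnP #|J|; first by rewrite J0 expr0n (gtn_eqF (ltnW n2)) mul0r !mulr0.
rewrite Tpoly_flat1 //; last by rewrite J0 -[n.+1 in leqRHS](card_ord) max_card.
have h : (-1) ^+ #|J| * (-1) ^+ #|J| = 1 :> R by rewrite -expr2 sqrr_sign.
rewrite exprD; move: ((-1) ^+ #|J|) ((-1) ^+ n.+1) h => a b h.
by transitivity (a * a * (b * #|J|%:R ^+ n)); [ring | rewrite h mul1r].
Qed.

Lemma face_functional_mesym n : (2 <= n)%N ->
  face_functional (mesym n.+1 R n.+1) = (-1) ^+ n.+1 / n.+1%:R.
Proof.
move=> n2; rewrite /face_functional (bigD1 [set: 'I_n.+1]%SET) //= big1 ?addr0 => [|J JT].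
  rewrite cardsT card_ord /peval mesym_flat cardsT card_ord binn div1r mul1r exprVn.
  rewrite [n.+1%:R ^+ n.+1]exprS invfM [X in _ * X]mulrCA mulfV ?mulr1 //.
  by rewrite expf_neq0 // pnatr_eq0.
rewrite /peval mesym_flat bin_small ?mul0r ?mulr0 //.
by rewrite -[n.+1 in ltnRHS](card_ord) -cardsT; apply: proper_card; rewrite properT.
Qed.

Lemma face_functional_mesymZ n : (2 <= n)%N ->
  rconst R n.+1 * face_functional (mesym n.+1 R n.+1) = face_functional (Tpoly R n.+1 n.+1).
Proof.
move=> n2; apply/eqP; rewrite -face_functionalZ eq_sym -subr_eq0 -face_functionalB.
by rewrite face_functional_eq0 ?deg_Tpoly_diff // ltnW.
Qed.

Lemma sum_card_gt0 n : 0 < \sum_(J : {set 'I_n.+1}) #|J|%:R ^+ n :> R.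
Proof.
rewrite (bigD1 [set: 'I_n.+1]%SET) //= ltr_wpDr ?exprn_gt0 ?sumr_ge0 // => [J _|].
  by rewrite exprn_ge0.
by rewrite cardsT card_ord ltr0n.
Qed.

Lemma rconst_gt0 k : (3 <= k)%N -> 0 < rconst R k.
Proof.
case: k => // n n2; have := face_functional_mesymZ n2.
rewrite face_functional_Tpoly // face_functional_mesym // mulrCA.
move/(mulfI (expf_neq0 n.+1 (_ : -1 != 0 :> R))); rewrite oppr_eq0 oner_eq0 => /(_ isT).
by move=> h; rewrite -(pmulr_lgt0 _ (_ : 0 < n.+1%:R^-1)) ?invr_gt0 ?ltr0n // h sum_card_gt0.
Qed.

(** Since [face_functional] is the same up to the factor r_d on T_d and on e_d - p,
    and T_d takes the values that maximize it among the functions bounded by 1 at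
    the barycenters, e_d - p must reach 1 / r_d in absolute value at one of them. *)
Lemma simplex_lower_bound n : (2 <= n)%N ->
  (rconst R n.+1)^-1 <=
  best_error n (fun x : 'rV[R]_n.+1 => \prod_(i < n.+1) x ord0 i) (@std_simplex R n.+1).
Proof.
move=> n2; have r0 : 0 < rconst R n.+1 by apply: rconst_gt0.
apply: (best_error_ge (@simplex_cube _ _) (@peval_prod _ _)) => p e hp he.
rewrite -div1r ler_pdivrMr // mulrC -(ler_pM2r (sum_card_gt0 n)) mul1r.
apply: (@le_trans _ _ `|face_functional (Tpoly R n.+1 n.+1)|).
  rewrite face_functional_Tpoly // normrM normrX normrN1 expr1n mul1r.
  exact: ler_norm.
rewrite -face_functional_mesymZ //.
have -> : face_functional (mesym n.+1 R n.+1) = face_functional (mesym n.+1 R n.+1 - p).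
  by rewrite face_functionalB (face_functional_eq0 _ hp) ?subr0 // ltnW.
rewrite normrM gtr0_norm // -mulrA ler_pM2l // mulr_sumr.
apply: (le_trans (ler_norm_sum _ _ _)); apply: ler_sum => J _.
rewrite !normrM normrX normrN1 expr1n mul1r [e * _]mulrC.
rewrite [`|_ ^+ n|]ger0_norm ?exprn_ge0 // ler_wpM2l ?exprn_ge0 //.
apply: (le_trans _ (he _ (flat_simplex R J))).
rewrite /peval mevalB mesymnnE rmorph_prod /=.
by under [X in `|X - _| <= _]eq_bigr do rewrite mevalXU.
Qed.

End LowerBound.

(** * Equalizing the nonzero coordinates *)

Section Smoothing.
Variables (R : realType) (n : nat).
Implicit Types (x : 'rV[R]_n) (f : 'rV[R]_n -> R) (i j : 'I_n).

Definition upd2 x i j (y z : R) : 'rV[R]_n :=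
  \row_l (if l == i then y else if l == j then z else x ord0 l).

(** The functions that are affine in the product x_i x_j of any two coordinates
    when their sum and all the other coordinates are fixed. *)
Definition pair_affine f := forall x i j, i != j -> exists a b : R,
  forall y z, y + z = x ord0 i + x ord0 j -> f (upd2 x i j y z) = a + b * (y * z).

Lemma upd2_id x i j : upd2 x i j (x ord0 i) (x ord0 j) = x.
Proof.
apply/rowP => l; rewrite mxE ord1.
by case: eqP => [->//|_]; case: eqP => [->|].
Qed.

Lemma upd2_i x i j y z : upd2 x i j y z ord0 i = y.
Proof. by rewrite mxE eqxx. Qed.

Lemma upd2_j x i j y z : i != j -> upd2 x i j y z ord0 j = z.
Proof. by move=> ij; rewrite mxE eq_sym (negbTE ij) eqxx. Qed.

Lemma upd2_out x i j y z l : l != i -> l != j -> upd2 x i j y z ord0 l = x ord0 l.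
Proof. by move=> /negbTE li /negbTE lj; rewrite mxE li lj. Qed.

Lemma sum_upd2 x i j y z : i != j -> y + z = x ord0 i + x ord0 j ->
  \sum_l upd2 x i j y z ord0 l = \sum_l x ord0 l.
Proof.
move=> ij yz; have ji : j != i by rewrite eq_sym.
rewrite [LHS](bigD1 i) //= [RHS](bigD1 i) //= (bigD1 j ji) [X in _ = _ + X](bigD1 j ji) /=.
rewrite upd2_i upd2_j // !addrA yz; congr (_ + _).
by apply: eq_bigr => l /andP[li lj]; rewrite upd2_out.
Qed.

Definition supp x : {set 'I_n} := [set l | x ord0 l != 0].
Definition mean x : R := (\sum_l x ord0 l) / #|supp x|%:R.
Definition off_mean x : {set 'I_n} := [set l in supp x | x ord0 l != mean x].

Lemma off_mean0 x : #|off_mean x| = 0%N -> x = flat (supp x) (\sum_l x ord0 l).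
Proof.
move=> h; apply/rowP => l; rewrite mxE ord1 -/(mean x).
have /setP/(_ l) := cards0_eq h; rewrite !inE; case: eqP => //= _ /negPn/eqP //.
Qed.

Lemma sum_supp x : \sum_(l in supp x) (x ord0 l - mean x) = 0.
Proof.
rewrite sumrB sumr_const -[X in _ - X]mulr_natr.
have -> : \sum_(l in supp x) x ord0 l = \sum_l x ord0 l.
  rewrite big_mkcond; apply: eq_bigr => l _; rewrite inE.
  by case: eqP => [->|].
have [c0|c0] := posnP #|supp x|; last by rewrite divfK ?subrr // pnatr_eq0 -lt0n.
rewrite c0 mulr0 subr0 big1 // => l _; apply/eqP/negPn.
by have /setP/(_ l) := cards0_eq c0; rewrite !inE => ->.
Qed.

Lemma off_mean_lt x : (0 < #|off_mean x|)%N -> exists2 i, i \in supp x & x ord0 i < mean x.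
Proof.
move=> /card_gt0P[l]; rewrite inE => /andP[ls lm].
case: (pickP (fun i => (i \in supp x) && (x ord0 i < mean x))) => [i /andP[]|h].
  by exists i.
have ge0 i : i \in supp x -> 0 <= x ord0 i - mean x.
  by move=> si; have := h i; rewrite si /= subr_ge0 leNgt => ->.
have /eqP := psumr_eq0P ge0 (sum_supp x) ls.
by rewrite subr_eq0 (negbTE lm).
Qed.

Lemma off_mean_gt x : (0 < #|off_mean x|)%N -> exists2 i, i \in supp x & mean x < x ord0 i.
Proof.
move=> /card_gt0P[l]; rewrite inE => /andP[ls lm].
case: (pickP (fun i => (i \in supp x) && (mean x < x ord0 i))) => [i /andP[]|h].
  by exists i.
have ge0 i : i \in supp x -> 0 <= - (x ord0 i - mean x).
  by move=> si; have := h i; rewrite si /= opprB subr_ge0 leNgt => ->.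
have s0 : \sum_(i in supp x) - (x ord0 i - mean x) = 0 by rewrite sumrN sum_supp oppr0.
have /eqP := psumr_eq0P ge0 s0 ls.
by rewrite oppr_eq0 subr_eq0 (negbTE lm).
Qed.

(** A finite version of an extremality argument. Unless all nonzero coordinates
    are equal, some x_i lies below their mean and some x_j above it. According to
    the sign of the coefficient of x_i x_j, the function does not decrease when
    x_i is moved to 0, which shrinks the support, or when it is moved to the mean,
    x_j absorbing the difference in either case. The second move leaves fewer
    coordinates different from the mean and keeps the support, so the
    lexicographic measure decreases in both cases. *)
Lemma smoothing f x : pair_affine f -> (forall i, 0 <= x ord0 i) ->
  exists S, f x <= f (flat S (\sum_l x ord0 l)).
Proof.
move=> haff; have [m] := ubnP (#|supp x| * n.+1 + #|off_mean x|)%N.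
elim: m x => // m IH x hm x0.
have [o0|o0] := posnP #|off_mean x|.
  by exists (supp x); rewrite -off_mean0.
have [i si xi] := off_mean_lt o0; have [j sj xj] := off_mean_gt o0.
have ij : i != j by apply: contraTneq (lt_trans xi xj) => ->; rewrite ltxx.
have [a [b hab]] := haff x i j ij.
have fx := hab _ _ (erefl _); rewrite upd2_id in fx.
have mean0 : 0 <= mean x by rewrite divr_ge0 ?ler0n ?sumr_ge0.
have step y z : 0 <= y -> 0 <= z -> y + z = x ord0 i + x ord0 j ->
    (#|supp (upd2 x i j y z)| * n.+1 + #|off_mean (upd2 x i j y z)| <
     #|supp x| * n.+1 + #|off_mean x|)%N -> b * (x ord0 i * x ord0 j) <= b * (y * z) ->
    exists S, f x <= f (flat S (\sum_l x ord0 l)).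
  move=> y0 z0 yz hlt hb; have [||S hS] := IH (upd2 x i j y z).
  - by rewrite -ltnS; apply: leq_trans hm; rewrite ltnS.
  - by move=> l; rewrite mxE; case: ifP => _ //; case: ifP.
  exists S; rewrite sum_upd2 // in hS; apply: le_trans hS.
  by rewrite fx hab // lerD2l.
have [b0|b0] := lerP b 0.
  (* The product can be decreased to 0, which shrinks the support. *)
  apply: (step 0 (x ord0 i + x ord0 j)); rewrite ?add0r ?addr_ge0 //.
    have sub : supp (upd2 x i j 0 (x ord0 i + x ord0 j)) \subset supp x :\ i.
      apply/fintype.subsetP => l; rewrite !inE.
      have [->|li] := eqVneq l i; first by rewrite upd2_i eqxx.
      have [->|lj] := eqVneq l j; first by move: sj; rewrite inE.
      by rewrite upd2_out.
    have := subset_leq_card sub; rewrite [#|supp x|](cardsD1 i) si => h.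
    set o := #|off_mean (upd2 _ _ _ _ _)|.
    have : (o <= n)%N by rewrite -[n in leqRHS]card_ord max_card.
    rewrite -ltnS => ho; rewrite mulnDl mul1n -addnA addnC.
    by rewrite -addSn; apply: leq_add => //; rewrite (leq_trans (leq_mul h (leqnn _))) // leq_addr.
  by rewrite mul0r mulr0 mulr_le0_ge0 // mulr_ge0.
apply: (step (mean x) (x ord0 i + x ord0 j - mean x)) => //.
- by have := x0 i; lra.
- by rewrite addrC subrK.
- have xi0 := x0 i; have z0 : 0 < x ord0 i + x ord0 j - mean x by lra.
  set x' := upd2 _ _ _ _ _.
  have m0 : 0 < mean x by apply: le_lt_trans xi.
  have ss : supp x' = supp x.
    apply/setP => l; rewrite !inE.
    have [->|li] := eqVneq l i; first by rewrite upd2_i gt_eqF //; move: si; rewrite inE => ->.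
    have [->|lj] := eqVneq l j.
      by rewrite upd2_j // gt_eqF //; move: sj; rewrite inE => ->.
    by rewrite upd2_out.
  have mm : mean x' = mean x.
    by rewrite /mean ss sum_upd2 // addrC subrK.
  rewrite ss ltn_add2l; apply: proper_card; apply/fintype.properP; split.
    apply/fintype.subsetP => l; rewrite !inE mm -!/(_ \in _).
    have [->|li] := eqVneq l i; first by rewrite upd2_i eqxx andbF.
    have [->|lj] := eqVneq l j.
      by rewrite (gt_eqF xj) => _; move: sj; rewrite inE => ->.
    by rewrite upd2_out.
  exists i; first by rewrite inE si lt_eqF.
  by rewrite inE mm upd2_i eqxx andbF.
rewrite ler_pM2l //; have : 0 <= (mean x - x ord0 i) * (x ord0 j - mean x).
  by rewrite mulr_ge0 // subr_ge0 ltW.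
by lra.
Qed.

Lemma pair_affineD f g : pair_affine f -> pair_affine g -> pair_affine (fun x => f x + g x).
Proof.
move=> hf hg x i j ij; have [a [b ab]] := hf x i j ij; have [c [d cd]] := hg x i j ij.
by exists (a + c), (b + d) => y z yz; rewrite ab // cd //; ring.
Qed.

Lemma pair_affineZ c f : pair_affine f -> pair_affine (fun x => c * f x).
Proof.
move=> hf x i j ij; have [a [b ab]] := hf x i j ij.
by exists (c * a), (c * b) => y z yz; rewrite ab //; ring.
Qed.

Lemma pair_affine_sum (g : R -> R) : pair_affine (fun x => g (\sum_l x ord0 l)).
Proof.
move=> x i j ij; exists (g (\sum_l x ord0 l)), 0 => y z yz.
by rewrite sum_upd2 // mul0r addr0.
Qed.

(** (1 + y X) (1 + z X) = 1 + (y + z) X + y z X^2. *)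
Lemma pair_affine_mesym k : pair_affine (fun x => (mesym n R k).@[x ord0]).
Proof.
move=> x i j ij.
pose Q := \prod_(l | (l != i) && (l != j)) (1 + x ord0 l *: 'X : {poly R}).
exists ((1 + (x ord0 i + x ord0 j) *: 'X) * Q)`_k, ('X^2 * Q)`_k => y z yz.
rewrite mesym_coef (bigD1 i) //= (bigD1 j) 1?eq_sym //= upd2_i upd2_j //.
rewrite (eq_bigr (fun l => 1 + x ord0 l *: 'X)) => [|l /andP[li lj]]; last by rewrite upd2_out.
rewrite -/Q -yz.
suff -> : (1 + y *: 'X) * ((1 + z *: 'X) * Q) =
    (1 + (y + z) *: 'X) * Q + (y * z) *: ('X^2 * Q) by rewrite coefD coefZ [_ * _`_k]mulrC.
by rewrite -!mul_polyC polyCD polyCM; ring.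
Qed.

Lemma pair_affine_eq f g : f =1 g -> pair_affine f -> pair_affine g.
Proof.
move=> fg hf x i j ij; have [a [b ab]] := hf x i j ij.
by exists a, b => y z yz; rewrite -fg ab.
Qed.

(** Apart from elementary symmetric polynomials, T_k only involves a function of
    the coordinate sum. *)
Lemma pair_affine_Tpoly k : (3 <= k)%N -> pair_affine (peval (Tpoly R k n)).
Proof.
move: k; apply: Tpoly_ind => [|k k3 IH].
  apply: (pair_affine_eq (f := fun x => 72 * (mesym n R 3).@[x ord0] +
    (- 8) * (mesym n R 2).@[x ord0] + (fun s => 1 - 4 * s + 4 * s ^+ 2) (\sum_l x ord0 l))).
    by move=> x; rewrite peval_Tpoly3 mesym1E meval_sumX; ring.
  apply: pair_affineD; last exact: (pair_affine_sum (fun s => 1 - 4 * s + 4 * s ^+ 2)).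
  by apply: pair_affineD; apply/pair_affineZ/pair_affine_mesym.
apply: (pair_affine_eq (f := fun x => rconst R k.+1 * (mesym n R k.+1).@[x ord0] +
    (-1) * peval (Tpoly R k n) x)).
  by move=> x; rewrite (@Tpoly_recE R k.+1 n) // /peval mevalB mevalZ mulN1r.
apply: pair_affineD; last exact: pair_affineZ.
exact/pair_affineZ/pair_affine_mesym.
Qed.

End Smoothing.

(** * The bound on T_d for d = 3, 4, 5 *)

Section UpperBound.
Variables (R : realType).

Lemma peval_Tpoly3_flat N (S : {set 'I_N}) (s : R) : peval (Tpoly R 3 N) (flat S s) =
  72 * ('C(#|S|, 3)%:R * (s / #|S|%:R) ^+ 3) - 8 * ('C(#|S|, 2)%:R * (s / #|S|%:R) ^+ 2)
  + (if (0 < #|S|)%N then 1 - 4 * s + 4 * s ^+ 2 else 1).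
Proof.
rewrite peval_Tpoly3 !mesym_flat bin1 expr1; case: ifPn => S0.
  by rewrite [#|S|%:R * _]mulrCA divff ?pnatr_eq0 -?lt0n //; ring.
have S00 : #|S|%:R = 0 :> R by move: S0; rewrite lt0n negbK => /eqP ->.
by rewrite S00 !mul0r; ring.
Qed.

Lemma binE5 : (('C(1, 1) = 1)%N * ('C(1, 2) = 0)%N * ('C(1, 3) = 0)%N * ('C(1, 4) = 0)%N
  * ('C(1, 5) = 0)%N
  * ('C(2, 2) = 1)%N * ('C(2, 3) = 0)%N * ('C(2, 4) = 0)%N * ('C(2, 5) = 0)%N
  * ('C(3, 2) = 3)%N * ('C(3, 3) = 1)%N * ('C(3, 4) = 0)%N * ('C(3, 5) = 0)%N
  * ('C(4, 2) = 6)%N * ('C(4, 3) = 4)%N * ('C(4, 4) = 1)%N * ('C(4, 5) = 0)%N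
  * ('C(5, 2) = 10)%N * ('C(5, 3) = 10)%N * ('C(5, 4) = 5)%N * ('C(5, 5) = 1)%N)%type.
Proof. by []. Qed.

Lemma rconst4 : rconst R 4 = 896.
Proof.
have c4 : #|[set: 'I_4]%SET| = 4 by rewrite cardsT card_ord.
rewrite (rconst_flat _ _ c4) // peval_Tpoly3_flat c4 !binE5 /=.
by field; rewrite ?pnatr_eq0.
Qed.

Lemma Tpoly4_flat N (S : {set 'I_N}) (s : R) : peval (Tpoly R 4 N) (flat S s) =
  896 * ('C(#|S|, 4)%:R * (s / #|S|%:R) ^+ 4) - peval (Tpoly R 3 N) (flat S s).
Proof. by rewrite (@Tpoly_recE R 4 N) // /peval mevalB mevalZ mesym_flat rconst4. Qed.

Lemma rconst5 : rconst R 5 = 14400.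
Proof.
have c5 : #|[set: 'I_5]%SET| = 5 by rewrite cardsT card_ord.
rewrite (rconst_flat _ _ c5) // Tpoly4_flat peval_Tpoly3_flat c5 !binE5 /=.
by field; rewrite ?pnatr_eq0.
Qed.

Lemma Tpoly5_flat N (S : {set 'I_N}) (s : R) : peval (Tpoly R 5 N) (flat S s) =
  14400 * ('C(#|S|, 5)%:R * (s / #|S|%:R) ^+ 5) - peval (Tpoly R 4 N) (flat S s).
Proof. by rewrite (@Tpoly_recE R 5 N) // /peval mevalB mevalZ mesym_flat rconst5. Qed.

Lemma Tpoly3_bound_flat N (S : {set 'I_N}) (s : R) :
  (#|S| <= 3)%N -> 0 <= s <= 1 -> `|peval (Tpoly R 3 N) (flat S s)| <= 1.
Proof.
move=> S3 /andP[s0 s1]; rewrite peval_Tpoly3_flat ler_norml.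
have t0 : 0 <= 1 - s by rewrite subr_ge0.
case: #|S| S3 => [|[|[|[|c]]]] //= _; rewrite ?bin0n ?binE5 /=.
- by apply/andP; split; lra.
- have := mulr_ge0 s0 t0; have := sqr_ge0 (1 - 2 * s).
  by move=> *; apply/andP; split; lra.
- have := mulr_ge0 s0 t0; have := sqr_ge0 (1 - s).
  by move=> *; apply/andP; split; lra.
- have := mulr_ge0 s0 t0; have := mulr_ge0 s0 (mulr_ge0 s0 t0).
  have := mulr_ge0 s0 (sqr_ge0 (s - 1 / 2)); have := sqr_ge0 (s - 7 / 12).
  by move=> *; apply/andP; split; lra.
Qed.

(** For |S| < 4 the value is that of - T_3. For |S| = 4 it is
    7/2 s^4 - 9/2 s^3 - s^2 + 4 s - 1, whose sum with 1 has a factor s and whose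
    difference to 1 has a factor 1 - s; the cofactors are sums of squares with
    nonnegative weights on [0,1]. *)
Lemma Tpoly4_bound_flat N (S : {set 'I_N}) (s : R) :
  (#|S| <= 4)%N -> 0 <= s <= 1 -> `|peval (Tpoly R 4 N) (flat S s)| <= 1.
Proof.
move=> S4 hs; rewrite Tpoly4_flat.
rewrite leq_eqVlt in S4; case/orP: S4 => [/eqP S4|S4]; last first.
  by rewrite bin_small // mul0r mulr0 sub0r normrN Tpoly3_bound_flat.
case/andP: hs => s0 s1; rewrite peval_Tpoly3_flat S4 !binE5 /= ler_norml.
have t0 : 0 <= 1 - s by rewrite subr_ge0.
apply/andP; split.
  have := mulr_ge0 (mulr_ge0 s0 s0) (sqr_ge0 (s - 1)).
  by have := mulr_ge0 s0 (sqr_ge0 (s - 9 / 10)); lra.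
have := mulr_ge0 (mulr_ge0 t0 s0) (sqr_ge0 (s - 3 / 5)).
by have := mulr_ge0 t0 t0; have := mulr_ge0 t0 (sqr_ge0 (s - 1 / 2)); lra.
Qed.

(** For |S| = 5, one minus the value has the factor s (1 - s), and one plus the
    value is a sum of squares weighted by powers of s, up to a remainder that is
    positive on [0,1]. The centers 7/9, 11/20 and 3/5 are rounded minimizers of the
    quadratic factors that occur. *)
Lemma Tpoly5_bound_flat N (S : {set 'I_N}) (s : R) :
  (#|S| <= 5)%N -> 0 <= s <= 1 -> `|peval (Tpoly R 5 N) (flat S s)| <= 1.
Proof.
move=> S5 hs; rewrite Tpoly5_flat.
rewrite leq_eqVlt in S5; case/orP: S5 => [/eqP S5|S5]; last first.
  by rewrite bin_small // mul0r mulr0 sub0r normrN Tpoly4_bound_flat.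
case/andP: hs => s0 s1; rewrite Tpoly4_flat peval_Tpoly3_flat S5 !binE5 /= ler_norml.
have t0 : 0 <= 1 - s by rewrite subr_ge0.
have s3 : 0 <= s ^+ 3 by apply: exprn_ge0.
apply/andP; split.
  have := mulr_ge0 s3 (sqr_ge0 (s - 7 / 9)); have := sqr_ge0 (s - 3 / 5).
  by have := mulr_ge0 s0 (sqr_ge0 (s - 11 / 20)); lra.
have u0 := mulr_ge0 s0 t0; have := mulr_ge0 u0 s3; have := mulr_ge0 u0 s0.
by have := mulr_ge0 u0 (mulr_ge0 t0 (addr_ge0 ler01 s0)); lra.
Qed.

Lemma Tpoly_bound_flat d N (S : {set 'I_N}) (s : R) : d \in [:: 3; 4; 5]%N ->
  (#|S| <= d)%N -> 0 <= s <= 1 -> `|peval (Tpoly R d N) (flat S s)| <= 1.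
Proof.
rewrite !inE => /or3P[] /eqP ->.
- exact: Tpoly3_bound_flat.
- exact: Tpoly4_bound_flat.
- exact: Tpoly5_bound_flat.
Qed.

Lemma Tpoly_bound d (x : 'rV[R]_d) : d \in [:: 3; 4; 5]%N -> std_simplex x ->
  `|peval (Tpoly R d d) x| <= 1.
Proof.
move=> hd [x0 sx].
have d3 : (3 <= d)%N by move: hd; rewrite !inE => /or3P[] /eqP ->.
have hs : 0 <= \sum_l x ord0 l <= 1 by rewrite sumr_ge0 //= -subr_ge0.
have bound S : `|peval (Tpoly R d d) (flat S (\sum_l x ord0 l))| <= 1.
  by apply: Tpoly_bound_flat; rewrite // -[d in leqRHS]card_ord max_card.
have affT := @pair_affine_Tpoly R d d d3.
have [S hS] := smoothing affT x0; have [S' hS'] := smoothing (pair_affineZ (-1) affT) x0.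
rewrite ler_norml; apply/andP; split.
  rewrite lerNl; apply: le_trans (bound S'); rewrite -mulN1r.
  by apply: le_trans hS' _; rewrite mulN1r -normrN ler_norm.
by apply: le_trans (bound S); apply: le_trans hS _; apply: ler_norm.
Qed.

End UpperBound.

(** * The extremal polynomials *)

Section Extremal.
Local Open Scope classical_set_scope.
Variable R : realType.

Lemma deg_monomial_sub_Tmonic d : (3 <= d)%N ->
  (msize ('X_[const_mnm d 1] - Tmonic R d d) <= d)%N.
Proof.
move=> d3; have r0 : rconst R d != 0 by rewrite gt_eqF // rconst_gt0.
have -> : 'X_[const_mnm d 1] = mesym d R d.
  by rewrite mesymnnE mpolyXE_id; apply: eq_bigr => i _; rewrite mnmE expr1.
rewrite -[mesym d R d](scalerK r0) -scalerBr -opprB; apply: degZ.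
by rewrite msizeN; apply: deg_Tpoly_diff.
Qed.

Lemma Tmonic_bound d (x : 'rV[R]_d) : d \in [:: 3; 4; 5]%N -> std_simplex x ->
  `|peval (Tmonic R d d) x| <= (rconst R d)^-1.
Proof.
move=> hd hx; have d3 : (3 <= d)%N by move: hd; rewrite !inE => /or3P[] /eqP ->.
have r0 : 0 < (rconst R d)^-1 by rewrite invr_gt0 rconst_gt0.
by rewrite /peval mevalZ normrM gtr0_norm // ler_piMr ?(ltW r0) // Tpoly_bound.
Qed.

Lemma best_error_le_of_monic n (Om : set 'rV[R]_n) f m (q : {mpoly R[n]}) (mon : {mpoly R[n]}) c :
  Om !=set0 -> (forall x, f x = peval mon x) -> (msize (mon - q) <= m.+1)%N ->
  (forall x, Om x -> `|peval q x| <= c) -> best_error m f Om <= c.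
Proof.
move=> O0 fE hq hc; apply: (best_error_le O0 hq) => x Ox.
by rewrite fE /peval mevalB opprB addrC subrK; apply: hc.
Qed.

(** A monic polynomial whose norm does not exceed a lower bound of the best error
    attains that error. *)
Lemma least_deviation_of_bound n (Om : set 'rV[R]_n) (al : 'X_{1..n}) f m (q : {mpoly R[n]}) c :
  Om !=set0 -> in_cube Om -> (forall x, f x = peval 'X_[al] x) -> m = (mdeg al).-1 ->
  (msize ('X_[al] - q) <= m.+1)%N -> (forall x, Om x -> `|peval q x| <= c) ->
  c <= best_error m f Om -> least_deviation al Om q.
Proof.
move=> O0 cO fE -> hq hc ge_c; exists ('X_[al] - q); split=> //; last by rewrite subKr.
have fX : f = peval 'X_[al] by apply: boolp.funext.
rewrite -fX; apply: le_anti; apply/andP; split.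
  apply: le_trans ge_c; apply: cnorm_le => // x Ox.
  by rewrite fX /peval mevalB opprB addrC subrK; apply: hc.
apply: (best_error_le O0 hq) => x Ox; exact: (le_cnorm (g := 'X_[al])).
Qed.

End Extremal.

Theorem theorem4p3 (R : realType) (d : nat) (hd : (3 <= d)%N) :
  let e_simplex :=
    best_error d.-1 (fun x : 'rV[R]_d => \prod_(i < d) x ord0 i) (@std_simplex R d) in
  let e_face :=
    best_error d.-1 (fun x : 'rV[R]_(d.-1) =>
               (\prod_(i < d.-1) x ord0 i) * (1 - \sum_(i < d.-1) x ord0 i))
       (@std_simplex R d.-1) in
  let e_ball :=
    best_error (2 * d).-1 (fun x : 'rV[R]_d => \prod_(i < d) x ord0 i ^+ 2)
       (@unit_ball R d) in
  let e_sphere :=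
    best_error (2 * d).-1 (fun x : 'rV[R]_d => \prod_(i < d) x ord0 i ^+ 2)
       (@unit_sphere R d) in
  let q := Tmonic R d d in
  [/\ e_simplex = e_face,
      (rconst R d)^-1 <= e_simplex
    & d \in [:: 3; 4; 5]%N ->
        e_simplex = (rconst R d)^-1 /\
        least_deviation (const_mnm d 1) (@std_simplex R d) q] /\
  [/\ e_ball = e_sphere,
      (rconst R d)^-1 <= e_ball
    & d \in [:: 3; 4; 5]%N ->
        [/\ e_ball = (rconst R d)^-1,
            least_deviation (const_mnm d 2) (@unit_ball R d) (subst_sq q)
          & least_deviation (const_mnm d 2) (@unit_sphere R d) (subst_sq q)]].
Proof.
case: d hd => // n n2 e_simplex e_face e_ball e_sphere q.
have sq_mon (x : 'rV[R]_n.+1) : \prod_(i < n.+1) x ord0 i ^+ 2 = peval 'X_[const_mnm n.+1 2] x.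
  by rewrite peval_const_mnm.
have h1 : e_sphere <= e_ball by exact: sphere_le_ball sq_mon.
have h2 : e_ball <= e_simplex by exact: ball_le_simplex.
have h3 : e_simplex <= e_face by apply: simplex_le_face; apply: ltnW n2.
have h4 : e_face <= e_sphere by exact: face_le_sphere.
have bs : e_ball = e_sphere by lra.
have sf : e_simplex = e_face by lra.
have bsx : e_ball = e_simplex by lra.
have lower : (rconst R n.+1)^-1 <= e_simplex by exact: simplex_lower_bound.
have mdegc c : mdeg (const_mnm n.+1 c) = (c * n.+1)%N.
  by rewrite mdegE; under eq_bigr do rewrite mnmE; rewrite sum_nat_const card_ord mulnC.
have degq := deg_monomial_sub_Tmonic R n2.
have degq2 : (msize ('X_[const_mnm n.+1 2] - subst_sq q) <= (2 * n.+1).-1.+1)%N.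
  have -> : 'X_[const_mnm n.+1 2] = subst_sq 'X_[const_mnm n.+1 1] :> {mpoly R[n.+1]}.
    rewrite /subst_sq comp_mpolyX mpolyXE_id; apply: eq_bigr => i _.
    by rewrite tnth_mktuple !mnmE expr1.
  rewrite /subst_sq -comp_mpolyB; apply: leq_trans (deg_subst_sq (m := n) degq) _.
  by rewrite mulnS.
have simplex_bound : n.+1 \in [:: 3; 4; 5]%N -> forall x, std_simplex x ->
    `|peval q x| <= (rconst R n.+1)^-1 by move=> hn x; apply: Tmonic_bound.
have ball_bound : n.+1 \in [:: 3; 4; 5]%N -> forall x, unit_ball x ->
    `|peval (subst_sq q) x| <= (rconst R n.+1)^-1.
  by move=> hn x /ball_sq_simplex Sx; rewrite peval_subst_sq; apply: simplex_bound.
have optimal : n.+1 \in [:: 3; 4; 5]%N -> e_simplex = (rconst R n.+1)^-1.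
  move=> hn; apply/le_anti; rewrite lower andbT.
  exact: best_error_le_of_monic (@simplex_neq0 _ _) (@peval_prod _ _) degq (simplex_bound hn).
have mdeg1 : n = (mdeg (const_mnm n.+1 1)).-1 by rewrite mdegc mul1n.
have mdeg2 : (2 * n.+1).-1 = (mdeg (const_mnm n.+1 2)).-1 by rewrite mdegc.
split; split=> //.
- move=> hn; split; first exact: optimal.
  by apply: (least_deviation_of_bound _ _ _ mdeg1 degq (simplex_bound hn) lower) => //;
    [apply: simplex_neq0|apply: simplex_cube|apply: peval_prod].
- by rewrite bsx.
move=> hn; split; first by rewrite bsx optimal.
  apply: (least_deviation_of_bound _ _ sq_mon mdeg2 degq2 (ball_bound hn)) => //.
  - exact: ball_neq0.
  - exact: ball_cube.
  - by rewrite -/e_ball bsx.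
apply: (least_deviation_of_bound _ _ sq_mon mdeg2 degq2 (c := (rconst R n.+1)^-1)) => //.
- exact: sphere_neq0.
- exact: sphere_cube.
- by move=> x /sphere_ball; apply: ball_bound.
- by rewrite -/e_sphere -bs bsx.
Qed.
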